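(* Let $R$ be a commutative ring with $1$ and let $\Lambda$ be a locally convex, row-finite $k$-graph satisfying the following aperiodicity condition: for every $v\in\Lambda^0$ there exists a boundary path $x\in v\Lambda^{\leq\infty}$ such that for all $\alpha,\beta\in\Lambda$ with $s(\alpha)=s(\beta)=v$, $\alpha\neq\beta$ implies $\alpha x\neq\beta x$. Let $\phi:\mathrm{KP}_R(\Lambda)\to A$ be an $R$-algebra homomorphism into an $R$-algebra $A$. If $\phi(rp_v)\neq0$ for all $r\in R\setminus\{0\}$ and all $v\in\Lambda^0$, then $\phi$ is injective.
   Context: $\mathbb N=\{0,1,2,\dots\}$, $k\geq 1$ is an integer, $e_1,\dots,e_k$ is the standard basis of $\mathbb N^k$, and $\leq$ on $\mathbb N^k$ is coordinatewise. A $k$-graph is a countable category $\Lambda$ with a functor $d:\Lambda\to\mathbb N^k$ (degree) satisfying the factorisation property: if $d(\lambda)=m+n$ with $m,n\in\mathbb N^k$, there are unique $\mu,\nu\in\Lambda$ with $d(\mu)=m$, $d(\nu)=n$, $\lambda=\mu\nu$. Morphisms are called paths; the set $\Lambda^0$ of objects (vertices) is identified with the set of paths of degree $0$; $r,s:\Lambda\to\Lambda^0$ are the codomain (range) and domain (source) maps, so $\lambda\mu$ is defined iff $s(\lambda)=r(\mu)$. Write $\Lambda^n=d^{-1}(n)$, $\Lambda^{\neq0}=\Lambda\setminus\Lambda^0$, $v\Lambda=\{\lambda:r(\lambda)=v\}$, $v\Lambda^n=v\Lambda\cap\Lambda^n$. $\Lambda$ is row-finite if every $v\Lambda^n$ is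 finite. $\Lambda$ is locally convex if for all $v\in\Lambda^0$, $i\neq j$, $\lambda\in v\Lambda^{e_i}$, $\mu\in v\Lambda^{e_j}$, the sets $s(\lambda)\Lambda^{e_j}$ and $s(\mu)\Lambda^{e_i}$ are nonempty. For $n\in\mathbb N^k$, $\Lambda^{\leq n}=\{\lambda\in\Lambda: d(\lambda)\leq n,\text{ and } d(\lambda)_i<n_i\text{ implies } s(\lambda)\Lambda^{e_i}=\emptyset\}$, and $v\Lambda^{\leq n}=v\Lambda\cap\Lambda^{\leq n}$. Boundary paths: for $m\in(\mathbb N\cup\{\infty\})^k$ let $\Omega_{k,m}$ be the $k$-graph with objects $\{p\in\mathbb N^k:p\leq m\}$, morphisms $(p,q)$ with $p\leq q\leq m$, $r(p,q)=p$, $s(p,q)=q$, $(p,q)(q,t)=(p,t)$, $d(p,q)=q-p$. A boundary path of degree $m$ is a degree-preserving functor $x:\Omega_{k,m}\to\Lambda$ such that whenever $p\leq m$ and $p_i=m_i$ (i.e. $p\,\Omega_{k,m}^{\leq e_i}=\{p\}$) we have $x(p)\Lambda^{e_i}=\emptyset$ (i.e. $x(p)\Lambda^{\leq e_i}=\{x(p)\}$); here $x(p):=x(p,p)$. Write $d(x)=m$, $r(x)=x(0)$; $\Lambda^{\leq\infty}$ is the set of boundary paths and $v\Lambda^{\leq\infty}=\{x\in\Lambda^{\leq\infty}:r(x)=v\}$. If $s(\lambda)=r(x)$, then $\lambda x$ is the unique boundary path of degree $d(\lambda)+d(x)$ with $(\lambda x)(0,d(\lambda))=\lambda$ and $(\lambda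 x)(d(\lambda)+p,d(\lambda)+q)=x(p,q)$. Kumjian-Pask families: for each $\lambda\in\Lambda^{\neq 0}$ let $\lambda^*$ be a formal symbol (ghost path), and let $G(\Lambda^{\neq0})=\{\lambda^*:\lambda\in\Lambda^{\neq0}\}$; for $v\in\Lambda^0$ put $v^*=v$. $R$-algebras are associative but need not be unital. A Kumjian-Pask $\Lambda$-family $(P,S)$ in an $R$-algebra $A$ consists of functions $P:\Lambda^0\to A$ and $S:\Lambda^{\neq0}\cup G(\Lambda^{\neq0})\to A$ such that, with the convention $S_v=S_{v^*}=P_v$ for $v\in\Lambda^0$: (KP1) $P_vP_w=\delta_{v,w}P_v$ for $v,w\in\Lambda^0$; (KP2) for $\lambda,\mu\in\Lambda^{\neq0}$ with $r(\mu)=s(\lambda)$: $S_\lambda S_\mu=S_{\lambda\mu}$, $S_{\mu^*}S_{\lambda^*}=S_{(\lambda\mu)^*}$, $P_{r(\lambda)}S_\lambda=S_\lambda=S_\lambda P_{s(\lambda)}$, $P_{s(\lambda)}S_{\lambda^*}=S_{\lambda^*}=S_{\lambda^*}P_{r(\lambda)}$ (the last two for all $\lambda\in\Lambda^{\ne0}$); (KP3$'$) for all $n\in\mathbb N^k\setminus\{0\}$ and $\lambda,\mu\in\Lambda^{\leq n}$: $S_{\lambda^*}S_\mu=\delta_{\lambda,\mu}P_{s(\lambda)}$; (KP4$'$) for all $v\in\Lambda^0$ and $n\in\mathbb N^k\setminus\{0\}$: $P_v=\sum_{\lambda\in v\Lambda^{\leq n}}S_\lambda S_{\lambda^*}$.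 $\mathrm{KP}_R(\Lambda)$ is the $R$-algebra generated by a universal Kumjian-Pask $\Lambda$-family $(p,s)$: every Kumjian-Pask $\Lambda$-family $(Q,T)$ in an $R$-algebra $A$ is the image of $(p,s)$ under a unique $R$-algebra homomorphism $\mathrm{KP}_R(\Lambda)\to A$. *)

(* Defs.v *)
From HB Require Import structures.
From mathcomp Require Import all_boot all_order all_algebra.
From mathcomp Require Import all_classical.

Set Implicit Arguments.
Unset Strict Implicit.
Unset Printing Implicit Defensive.

Import GRing.Theory.
Local Open Scope classical_set_scope.
Local Open Scope ring_scope.

(* N^k, with the pointwise addition that MathComp puts on finite functions. *)
Definition deg (k : nat) := {ffun 'I_k -> nat}.

Definition unit_deg (k : nat) (i : 'I_k) : deg k := [ffun j => (j == i) : nat].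

Definition deg_le (k : nat) (m n : deg k) : Prop := forall i, (m i <= n i)%N.

(* (N u {oo})^k; None stands for oo. *)
Definition xdeg (k : nat) := {ffun 'I_k -> option nat}.

Definition deg_le_ext (k : nat) (p : deg k) (m : xdeg k) : Prop :=
  forall i, if m i is Some a then (p i <= a)%N else true.

Definition deg_add_ext (k : nat) (p : deg k) (m : xdeg k) : xdeg k :=
  [ffun i => omap (addn (p i)) (m i)].

(* [kcomp la mu] is the composite "la mu", which exists when src la = rng mu;
   on other pairs its value is unconstrained and never used.
   Countability of the category is the countType structure on its paths.
   By kfact, the paths of degree 0 are exactly the identities, so vertices are
   identified with them through kid. *)
Record kgraph (k : nat) := KGraph {
  vertex : countType;
  kpath : countType;
  rng : kpath -> vertex;
  src : kpath -> vertex;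
  kid : vertex -> kpath;
  kcomp : kpath -> kpath -> kpath;
  kdeg : kpath -> deg k;
  rng_kid : forall v, rng (kid v) = v;
  src_kid : forall v, src (kid v) = v;
  rng_kcomp : forall la mu, src la = rng mu -> rng (kcomp la mu) = rng la;
  src_kcomp : forall la mu, src la = rng mu -> src (kcomp la mu) = src mu;
  kcomp1l : forall la, kcomp (kid (rng la)) la = la;
  kcomp1r : forall la, kcomp la (kid (src la)) = la;
  kcompA : forall la mu nu, src la = rng mu -> src mu = rng nu ->
    kcomp la (kcomp mu nu) = kcomp (kcomp la mu) nu;
  kdeg_kid : forall v, kdeg (kid v) = 0;
  kdeg_kcomp : forall la mu, src la = rng mu ->
    kdeg (kcomp la mu) = kdeg la + kdeg mu;
  kfact : forall la m n, kdeg la = m + n ->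
    exists! mn : kpath * kpath,
      [/\ kdeg mn.1 = m, kdeg mn.2 = n, src mn.1 = rng mn.2
        & la = kcomp mn.1 mn.2]
}.

Section KGraphs.
Variables (k : nat) (L : kgraph k).
Implicit Types (v : vertex L) (la mu : kpath L) (m n p q t : deg k).

Definition paths_at v n : set (kpath L) :=
  [set la | rng la = v /\ kdeg la = n].

Definition row_finite : Prop := forall v n, finite_set (paths_at v n).

Definition locally_convex : Prop :=
  forall v (i j : 'I_k), i != j ->
  forall la mu, paths_at v (unit_deg i) la -> paths_at v (unit_deg j) mu ->
    paths_at (src la) (unit_deg j) !=set0 /\
    paths_at (src mu) (unit_deg i) !=set0.

Definition paths_le n : set (kpath L) :=
  [set la | deg_le (kdeg la) n /\
    forall i, (kdeg la i < n i)%N -> paths_at (src la) (unit_deg i) = set0].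

Definition paths_le_at v n : set (kpath L) :=
  [set la | rng la = v /\ paths_le n la].

(* A degree-preserving functor x from Omega_{k,m}: bmap p q is x(p,q), and only
   its values at p <= q <= m are meaningful.  The object x(p) is the range of
   x(p,p). *)
Record boundary_path := BoundaryPath {
  bdeg : xdeg k;
  bmap : deg k -> deg k -> kpath L;
  bmap_deg : forall p q, deg_le p q -> deg_le_ext q bdeg ->
    forall i, kdeg (bmap p q) i = (q i - p i)%N;
  bmap_rng : forall p q, deg_le p q -> deg_le_ext q bdeg ->
    rng (bmap p q) = rng (bmap p p);
  bmap_src : forall p q, deg_le p q -> deg_le_ext q bdeg ->
    src (bmap p q) = rng (bmap q q);
  bmap_id : forall p, deg_le_ext p bdeg -> bmap p p = kid (rng (bmap p p));
  bmap_comp : forall p q t, deg_le p q -> deg_le q t -> deg_le_ext t bdeg ->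
    bmap p t = kcomp (bmap p q) (bmap q t);
  bmap_boundary : forall p i, deg_le_ext p bdeg -> bdeg i = Some (p i) ->
    paths_at (rng (bmap p p)) (unit_deg i) = set0
}.

Definition brng (x : boundary_path) : vertex L := rng (bmap x 0 0).

(* Equality as functors, i.e. disregarding bmap outside p <= q <= m. *)
Definition bpath_eq (x y : boundary_path) : Prop :=
  bdeg x = bdeg y /\
  forall p q, deg_le p q -> deg_le_ext q (bdeg x) -> bmap x p q = bmap y p q.

(* "y is la x".  When L is locally convex and src la = brng x, there is exactly
   one such y up to bpath_eq. *)
Definition is_concat la (x y : boundary_path) : Prop :=
  [/\ bdeg y = deg_add_ext (kdeg la) (bdeg x),
      bmap y 0 (kdeg la) = la
    & forall p q, deg_le p q -> deg_le_ext q (bdeg x) ->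
        bmap y (kdeg la + p) (kdeg la + q) = bmap x p q].

Definition aperiodic : Prop :=
  forall v, exists x : boundary_path, brng x = v /\
    forall al be, src al = v -> src be = v -> al <> be ->
    forall alx bex, is_concat al x alx -> is_concat be x bex ->
      ~ bpath_eq alx bex.

End KGraphs.

(* Associative, not necessarily unital, R-algebras; MathComp has only unital
   ones. *)
Record nualgType (R : comPzRingType) := NuAlg {
  nualg_sort :> lmodType R;
  amul : nualg_sort -> nualg_sort -> nualg_sort;
  amulA : forall a b c, amul a (amul b c) = amul (amul a b) c;
  amulDl : forall a b c, amul (a + b) c = amul a c + amul b c;
  amulDr : forall a b c, amul a (b + c) = amul a b + amul a c;
  amulZl : forall (z : R) a b, amul (z *: a) b = z *: amul a b;
  amulZr : forall (z : R) a b, amul a (z *: b) = z *: amul a b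
}.

Definition alg_hom (R : comPzRingType) (A B : nualgType R) (f : A -> B) : Prop :=
  [/\ forall a b, f (a + b) = f a + f b,
      forall (z : R) a, f (z *: a) = z *: f a
    & forall a b, f (amul a b) = amul (f a) (f b)].

(* kpS la is S_la and kpG la is S_{la^*}.  Both are defined on all paths, with
   the convention S_v = S_{v^*} = P_v as the fields kpS_id and kpG_id, so the
   data amounts to P on vertices and S on non-vertex paths and ghost paths.
   The sum in KP4 is a finite-support sum; its index set is finite for
   row-finite L. *)
Record kp_family (k : nat) (L : kgraph k) (R : comPzRingType) (A : nualgType R) :=
KPFamily {
  kpP : vertex L -> A;
  kpS : kpath L -> A;
  kpG : kpath L -> A;
  kpS_id : forall v, kpS (kid v) = kpP v;
  kpG_id : forall v, kpG (kid v) = kpP v;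
  kp1 : forall v w, amul (kpP v) (kpP w) = if v == w then kpP v else 0;
  kp2_S : forall la mu, kdeg la != 0 -> kdeg mu != 0 -> rng mu = src la ->
    amul (kpS la) (kpS mu) = kpS (kcomp la mu);
  kp2_G : forall la mu, kdeg la != 0 -> kdeg mu != 0 -> rng mu = src la ->
    amul (kpG mu) (kpG la) = kpG (kcomp la mu);
  kp2_PS : forall la, kdeg la != 0 -> amul (kpP (rng la)) (kpS la) = kpS la;
  kp2_SP : forall la, kdeg la != 0 -> amul (kpS la) (kpP (src la)) = kpS la;
  kp2_PG : forall la, kdeg la != 0 -> amul (kpP (src la)) (kpG la) = kpG la;
  kp2_GP : forall la, kdeg la != 0 -> amul (kpG la) (kpP (rng la)) = kpG la;
  kp3 : forall (n : deg k), n != 0 ->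
    forall la mu, paths_le n la -> paths_le n mu ->
      amul (kpG la) (kpS mu) = if la == mu then kpP (src la) else 0;
  kp4 : forall v (n : deg k), n != 0 ->
    kpP v = \sum_(la \in paths_le_at v n) amul (kpS la) (kpG la)
}.

Definition kp_maps (k : nat) (L : kgraph k) (R : comPzRingType)
    (A B : nualgType R) (f : A -> B)
    (ps : kp_family L A) (QT : kp_family L B) : Prop :=
  [/\ forall v, f (kpP ps v) = kpP QT v,
      forall la, f (kpS ps la) = kpS QT la
    & forall la, f (kpG ps la) = kpG QT la].

(* K, with the family ps, is the Kumjian-Pask algebra KP_R(L).  That K is
   generated by ps follows from the uniqueness clause. *)
Definition is_KP_algebra (k : nat) (L : kgraph k) (R : comPzRingType)
    (K : nualgType R) (ps : kp_family L K) : Prop :=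
  forall (B : nualgType R) (QT : kp_family L B),
    (exists f : K -> B, alg_hom f /\ kp_maps f ps QT) /\
    (forall f g : K -> B, alg_hom f -> kp_maps f ps QT ->
       alg_hom g -> kp_maps g ps QT -> f =1 g).

(* Main.v *)
(* Every element of KP_R(Lambda) is a combination of elements S_al S_be^*,
   where all be lie in one Lambda^{<=n}.
   Multiplying on the right by S_be leaves a combination of paths S_al with a
   common source v.  If x is an aperiodic boundary path at v and m <= d(x) is
   large, then compressing by S_{al x(0,m)}^* and S_{x(0,m)} kills every term
   except that of al, which becomes its coefficient times a vertex projection.
   So no nonzero coefficient survives in the kernel of phi; the grading of
   KP_R(Lambda) plays no role. *)
Require Import Defs.
From HB Require Import structures.
From mathcomp Require Import all_boot all_order all_algebra.
From mathcomp Require Import finmap.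
From mathcomp Require Import all_classical.
From mathcomp Require Import zify.

Set Implicit Arguments.
Unset Strict Implicit.
Unset Printing Implicit Defensive.

Import GRing.Theory.
Local Open Scope classical_set_scope.
Local Open Scope ring_scope.

(** * Order and truncated subtraction on degrees, finite and extended *)

Section Degrees.
Variable k : nat.
Implicit Types m n p q : deg k.

Definition deg_sub m n : deg k := [ffun i => (m i - n i)%N].
Definition deg_max m n : deg k := [ffun i => maxn (m i) (n i)].

Lemma deg_addE m n i : (m + n) i = (m i + n i)%N. Proof. by rewrite ffunE. Qed.

Lemma deg0E i : (0 : deg k) i = 0%N. Proof. by rewrite ffunE. Qed.

Definition degE := (deg_addE, deg0E).

Lemma deg_subK m n : deg_le n m -> n + deg_sub m n = m.
Proof. by move=> le; apply/ffunP => i; rewrite !degE ffunE subnKC. Qed.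

Lemma deg_le0 n : deg_le 0 n. Proof. by move=> i; rewrite degE. Qed.

Lemma deg_le_refl n : deg_le n n. Proof. by move=> i. Qed.

Lemma deg_le_trans n m p : deg_le m n -> deg_le n p -> deg_le m p.
Proof. by move=> mn np i; apply: leq_trans (mn i) (np i). Qed.

Lemma deg_le_addr m n : deg_le m (m + n).
Proof. by move=> i; rewrite degE leq_addr. Qed.

Lemma deg_le_maxl m n : deg_le m (deg_max m n).
Proof. by move=> i; rewrite ffunE leq_maxl. Qed.

Lemma deg_le_maxr m n : deg_le n (deg_max m n).
Proof. by move=> i; rewrite ffunE leq_maxr. Qed.

Lemma deg_addKl m n : deg_sub (m + n) m = n.
Proof. by apply/ffunP => i; rewrite ffunE degE addKn. Qed.

(** Subtraction is truncated, so [n + deg_sub m n] is the join of m and n. *)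
Lemma deg_le_sub_add m n : deg_le m (n + deg_sub m n).
Proof. by move=> i; rewrite !(degE, ffunE) -maxnE leq_maxr. Qed.

Lemma deg_le_ext0 (D : xdeg k) : deg_le_ext 0 D.
Proof. by move=> i; case: (D i) => // a; rewrite degE. Qed.

Lemma deg_le_ext_trans n m (D : xdeg k) :
  deg_le m n -> deg_le_ext n D -> deg_le_ext m D.
Proof.
by move=> mn nD i; move: (nD i); case: (D i) => // a; apply: leq_trans (mn i).
Qed.

Lemma deg_le_ext_max m n (D : xdeg k) :
  deg_le_ext m D -> deg_le_ext n D -> deg_le_ext (deg_max m n) D.
Proof.
move=> mD nD i; move: (mD i) (nD i); case: (D i) => // a.
by rewrite ffunE geq_max => -> ->.
Qed.

Lemma deg_le_ext_sub m n (D : xdeg k) :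
  deg_le_ext m (deg_add_ext n D) -> deg_le_ext (deg_sub m n) D.
Proof.
move=> mD i; move: (mD i); rewrite !ffunE; case: (D i) => //= a.
by rewrite leq_subLR.
Qed.

Lemma finite_deg_le n : finite_set [set m | deg_le m n].
Proof.
pose N := \max_i n i.
pose f (g : {ffun 'I_k -> 'I_N.+1}) : deg k := [ffun i => g i : nat].
apply: (@sub_finite_set _ _ (f @` [set: {ffun 'I_k -> 'I_N.+1}])).
  move=> m mn; exists [ffun i => inord (m i)] => //.
  apply/ffunP => i; rewrite !ffunE inordK // ltnS.
  by apply: leq_trans (mn i) _; rewrite /N; apply: leq_bigmax.
exact/finite_image/finite_finset.
Qed.

End Degrees.

(** * Unique factorisation and the sets of paths below a degree *)

Section Paths.
Variables (k : nat) (L : kgraph k).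
Implicit Types (v : vertex L) (la mu nu : kpath L) (m n p q : deg k).

(** Cancellation in N^k also equates the degrees of the second factors, so uniqueness in [kfact]
    applies to the two factorisations. *)
Lemma kcomp_inj la mu la' mu' : src la = rng mu -> src la' = rng mu' ->
  kdeg la = kdeg la' -> kcomp la mu = kcomp la' mu' -> la = la' /\ mu = mu'.
Proof.
move=> c c' d e.
have dd : kdeg mu = kdeg mu'.
  move/(congr1 (@kdeg _ _)): e; rewrite !kdeg_kcomp // d => e.
  by apply/ffunP => i; move/ffunP/(_ i): e; rewrite !degE => /addnI.
have [xy [_ U]] := kfact (kdeg_kcomp c).
have xyE : xy = (la, mu) by apply: U.
have : xy = (la', mu') by apply: U; rewrite /= -d -dd -e.
by rewrite xyE => -[-> ->].
Qed.

Lemma kid_inj : injective (@kid k L).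
Proof. by move=> v w e; rewrite -[v](@rng_kid k L) e rng_kid. Qed.

(** Composing with the identity at the source or at the range factors la in two ways whose first
    factors have degree 0; by uniqueness they agree. *)
Lemma kpath_deg0 la : kdeg la = 0 -> la = kid (rng la).
Proof.
move=> d0; have [] // := @kcomp_inj la (kid (src la)) (kid (rng la)) la.
- by rewrite rng_kid.
- by rewrite src_kid.
- by rewrite kdeg_kid.
- by rewrite kcomp1l kcomp1r.
Qed.

Lemma src_deg0 la : kdeg la = 0 -> src la = rng la.
Proof. by move=> /kpath_deg0 ->; rewrite src_kid rng_kid. Qed.

(** The pair la(0,m), la(m,d(la)). The default [(la, la)] is taken exactly when m <= d(la) fails. *)
Definition ksplit la m : kpath L * kpath L :=
  xget (la, la) [set mn | [/\ kdeg mn.1 = m, src mn.1 = rng mn.2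
                            & la = kcomp mn.1 mn.2]].
Definition khead la m := (ksplit la m).1.
Definition ktail la m := (ksplit la m).2.

Lemma ksplitP la m : deg_le m (kdeg la) ->
  [/\ kdeg (khead la m) = m, src (khead la m) = rng (ktail la m)
    & la = kcomp (khead la m) (ktail la m)].
Proof.
move=> /deg_subK/esym/kfact[mn [[d1 _ c e] _]].
rewrite /khead /ktail /ksplit; case: xgetP => [? -> //|/(_ mn)].
by case; split.
Qed.

Lemma ksplit_comp la mu : src la = rng mu ->
  khead (kcomp la mu) (kdeg la) = la /\ ktail (kcomp la mu) (kdeg la) = mu.
Proof.
move=> c; have [|d c' e] := @ksplitP (kcomp la mu) (kdeg la).
  by rewrite kdeg_kcomp //; apply: deg_le_addr.
by have [] := kcomp_inj c c' (esym d) e.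
Qed.

Lemma rng_khead la m : deg_le m (kdeg la) -> rng (khead la m) = rng la.
Proof. by move=> /ksplitP[_ c {2}->]; rewrite rng_kcomp. Qed.

Lemma src_ktail la m : deg_le m (kdeg la) -> src (ktail la m) = src la.
Proof. by move=> /ksplitP[_ c {2}->]; rewrite src_kcomp. Qed.

Lemma kdeg_ktail la m : deg_le m (kdeg la) ->
  kdeg (ktail la m) = deg_sub (kdeg la) m.
Proof.
by move=> /ksplitP[d c {2}->]; rewrite kdeg_kcomp // d deg_addKl.
Qed.

Lemma khead_comp la mu m : src la = rng mu -> deg_le m (kdeg la) ->
  khead (kcomp la mu) m = khead la m.
Proof.
move=> c /[dup] le /ksplitP[d c' e].
have ct : src (ktail la m) = rng mu by rewrite src_ktail.
rewrite [in LHS]e -kcompA // -[X in khead _ X]d.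
have [|//] := @ksplit_comp (khead la m) (kcomp (ktail la m) mu).
by rewrite rng_kcomp.
Qed.

Lemma khead_id la : khead la (kdeg la) = la.
Proof.
by have [|] := @ksplit_comp la (kid (src la)); rewrite ?rng_kid // kcomp1r.
Qed.

Lemma khead_khead la p q : deg_le p q -> deg_le q (kdeg la) ->
  khead (khead la q) p = khead la p.
Proof.
move=> pq /ksplitP[d c e]; rewrite [in RHS]e khead_comp // d; exact: pq.
Qed.

(** Otherwise the initial segment of la of degree e_i would be such an edge. *)
Lemma no_edge_deg la i : paths_at (rng la) (unit_deg i) = set0 ->
  kdeg la i = 0%N.
Proof.
move=> E; apply/eqP; case: ltngtP => // gt0.
have le : deg_le (unit_deg i) (kdeg la).
  by move=> j; rewrite ffunE; case: eqP => // ->.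
have [d c e] := ksplitP le.
suff : paths_at (rng la) (unit_deg i) (khead la (unit_deg i)) by rewrite E.
by split=> //; rewrite rng_khead.
Qed.

Lemma paths_le_kdeg la : paths_le (kdeg la) la.
Proof. by split=> // i; rewrite ltnn. Qed.

(** The coordinates where d(la mu) falls short of n are those where d(mu) falls short of n - d(la).
    This brings a path into Lambda^{<=n}, where (KP3') applies. *)
Lemma paths_le_comp la mu n : src la = rng mu -> deg_le (kdeg la) n ->
  paths_le (deg_sub n (kdeg la)) mu -> paths_le n (kcomp la mu).
Proof.
move=> c len [d1 d2]; split=> i; rewrite ?src_kcomp // kdeg_kcomp // degE.
  by move: (d1 i); rewrite !ffunE; move: (len i); lia.
by move=> lt; apply: d2; rewrite ffunE; lia.
Qed.

Lemma finite_paths_le : row_finite L ->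
  forall v n, finite_set (@paths_le_at k L v n).
Proof.
move=> rf v n.
apply: (@sub_finite_set _ _ (\bigcup_(m in [set m | deg_le m n]) paths_at v m)).
  by move=> la [r [d _]]; exists (kdeg la).
by apply: bigcup_finite => [|m _]; [apply: finite_deg_le|apply: rf].
Qed.

(** Induction on the total length of la. The first edge of la has some degree e_j with j != i, and
    local convexity carries the edge of degree e_i from its range to its source. *)
Lemma locally_convex_src : locally_convex L -> forall la i,
  kdeg la i = 0%N -> paths_at (rng la) (unit_deg i) !=set0 ->
  paths_at (src la) (unit_deg i) !=set0.
Proof.
move=> lc la i; have [N] := ubnP (\sum_j kdeg la j)%N.
elim: N la => // N IH la ltN di ne.
have [d0|/eqP dn0] := eqVneq (kdeg la) 0; first by rewrite src_deg0.
have /existsNP[j dj] : ~ kdeg la =1 (0 : deg k) by move/ffunP.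
have jgt : (0 < kdeg la j)%N by case: (kdeg la j) dj => //; rewrite degE.
have ij : i != j by apply/eqP => e; rewrite -e di in jgt.
have le : deg_le (unit_deg j) (kdeg la).
  by move=> l; rewrite ffunE; case: eqP => // ->.
have [d c e] := ksplitP le.
have dE l : kdeg la l = ((l == j) + kdeg (ktail la (unit_deg j)) l)%N.
  by rewrite {1}e kdeg_kcomp // d degE ffunE.
rewrite -(src_ktail le); apply: IH.
- move: ltN; under eq_bigr do rewrite dE.
  by rewrite big_split /= (bigD1 j) //= eqxx; lia.
- by have := dE i; rewrite di (negPf ij); lia.
- rewrite -c; case: ne => mu mu_i.
  have e_j : paths_at (rng la) (unit_deg j) (khead la (unit_deg j)).
    by split=> //; rewrite rng_khead.
  by have [] := lc _ _ _ ij _ _ mu_i e_j.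
Qed.

End Paths.

(** * Concatenating a path with a boundary path *)

Section BoundaryPaths.
Variables (k : nat) (L : kgraph k) (hLC : locally_convex L).
Variable x : boundary_path L.
Implicit Types (al be : kpath L) (m n p q t : deg k).

Definition xhead m := bmap x 0 m.

Lemma rng_xhead m : deg_le_ext m (bdeg x) -> rng (xhead m) = brng x.
Proof. by move=> mx; rewrite /xhead bmap_rng //; apply: deg_le0. Qed.

Lemma kdeg_xhead m : deg_le_ext m (bdeg x) -> kdeg (xhead m) = m.
Proof.
move=> mx; apply/ffunP => i.
by rewrite bmap_deg // ?degE ?subn0 //; apply: deg_le0.
Qed.

Lemma src_xhead m : deg_le_ext m (bdeg x) -> src (xhead m) = rng (bmap x m m).
Proof. by move=> mx; rewrite bmap_src //; apply: deg_le0. Qed.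

Lemma src_xheadE m n : deg_le m n -> deg_le_ext n (bdeg x) ->
  src (xhead m) = rng (bmap x m n).
Proof.
move=> mn nx; rewrite src_xhead; first by rewrite -(bmap_rng mn nx).
exact: deg_le_ext_trans nx.
Qed.

Lemma xhead_comp m n : deg_le m n -> deg_le_ext n (bdeg x) ->
  xhead n = kcomp (xhead m) (bmap x m n).
Proof. by move=> mn nx; rewrite -bmap_comp //; apply: deg_le0. Qed.

(* [(al x)(0, q)] *)
Definition concat_head al q :=
  khead (kcomp al (xhead (deg_sub q (kdeg al)))) q.

Section Concat.
Variable al : kpath L.
Hypothesis al_x : src al = brng x.
Let D := deg_add_ext (kdeg al) (bdeg x).

(** The m used in [concat_head] is the least with q <= d(al) + m, and a longer segment of x leaves
    the first q steps unchanged. *)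
Lemma concat_headP q m : deg_le_ext m (bdeg x) -> deg_le q (kdeg al + m) ->
  concat_head al q = khead (kcomp al (xhead m)) q.
Proof.
move=> mx qm; have le : deg_le (deg_sub q (kdeg al)) m.
  by move=> i; move: (qm i); rewrite degE ffunE leq_subLR.
have lex := deg_le_ext_trans le mx.
have c : src al = rng (xhead (deg_sub q (kdeg al))) by rewrite rng_xhead.
rewrite (xhead_comp le mx) kcompA //; last exact: src_xheadE.
rewrite [RHS]khead_comp //; first by rewrite src_kcomp //; apply: src_xheadE.
rewrite kdeg_kcomp // kdeg_xhead //; exact: deg_le_sub_add.
Qed.

Lemma concat_head_add m : deg_le_ext m (bdeg x) ->
  concat_head al (kdeg al + m) = kcomp al (xhead m).
Proof.
move=> mx; rewrite (concat_headP mx) //.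
by rewrite -{2}(kdeg_xhead mx) -kdeg_kcomp ?khead_id // rng_xhead.
Qed.

Lemma kdeg_concat_comp q : deg_le_ext q D ->
  deg_le q (kdeg (kcomp al (xhead (deg_sub q (kdeg al))))).
Proof.
move=> /deg_le_ext_sub qx; rewrite kdeg_kcomp ?rng_xhead // kdeg_xhead //.
exact: deg_le_sub_add.
Qed.

Lemma kdeg_concat_head q : deg_le_ext q D -> kdeg (concat_head al q) = q.
Proof. by move=> /kdeg_concat_comp/ksplitP[]. Qed.

(** Both initial segments can be cut from the single path [kcomp al (xhead (deg_sub q (kdeg al)))],
    hence they are nested. *)
Lemma concat_head_split p q : deg_le p q -> deg_le_ext q D ->
  [/\ deg_le p (kdeg (concat_head al q)),
    khead (concat_head al q) p = concat_head al p,
    src (concat_head al p) = rng (ktail (concat_head al q) p)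
    & concat_head al q = kcomp (concat_head al p) (ktail (concat_head al q) p)].
Proof.
move=> pq qD; have le : deg_le p (kdeg (concat_head al q)).
  by rewrite kdeg_concat_head.
have qx := deg_le_ext_sub qD.
have e : khead (concat_head al q) p = concat_head al p.
  rewrite khead_khead //; last exact: kdeg_concat_comp.
  rewrite (concat_headP qx) //.
  exact: (deg_le_trans pq (@deg_le_sub_add _ _ _)).
by have [] := ksplitP le; rewrite e; split.
Qed.

(** This is (al x)(p,q). *)
Definition concat_map p q := ktail (concat_head al q) p.

Lemma rng_concat_map p q : deg_le p q -> deg_le_ext q D ->
  rng (concat_map p q) = src (concat_head al p).
Proof. by move=> pq /(concat_head_split pq)[]. Qed.

Lemma src_concat_map p q : deg_le p q -> deg_le_ext q D ->
  src (concat_map p q) = src (concat_head al q).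
Proof. by move=> pq /(concat_head_split pq)[le _ _ _]; rewrite src_ktail. Qed.

Lemma kdeg_concat_map p q : deg_le p q -> deg_le_ext q D ->
  kdeg (concat_map p q) = deg_sub q p.
Proof.
move=> pq qD; have [le _ _ _] := concat_head_split pq qD.
by rewrite kdeg_ktail // kdeg_concat_head.
Qed.

(** Left cancellation of (al x)(0,p). It reduces the functor laws for al x to equations between
    initial segments. *)
Lemma concat_mapE p q la : deg_le p q -> deg_le_ext q D ->
  src (concat_head al p) = rng la ->
  concat_head al q = kcomp (concat_head al p) la -> concat_map p q = la.
Proof.
move=> pq qD c e; have [_ _ c' e'] := concat_head_split pq qD.
by have [] := kcomp_inj c' c erefl _; rewrite -?e -?e'.
Qed.

Lemma concat_map_id p : deg_le_ext p D ->
  concat_map p p = kid (src (concat_head al p)).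
Proof.
move=> pD; apply: concat_mapE => //; first by rewrite rng_kid.
by rewrite kcomp1r.
Qed.

Lemma concat_map_add p q : deg_le p q -> deg_le_ext q (bdeg x) ->
  concat_map (kdeg al + p) (kdeg al + q) = bmap x p q.
Proof.
move=> pq qx; have px := deg_le_ext_trans pq qx.
apply: concat_mapE.
- by move=> i; rewrite !degE leq_add2l.
- move=> i; move: (qx i); rewrite ffunE degE; case: (bdeg x i) => //= a.
  by rewrite leq_add2l.
- by rewrite concat_head_add // src_kcomp ?rng_xhead //; apply: src_xheadE.
- rewrite !concat_head_add // (xhead_comp pq qx) kcompA ?rng_xhead //.
  exact: src_xheadE.
Qed.

(** Since p need not dominate d(al), compare it with the join q of p and d(al). At q the boundary
    condition of x excludes edges of degree e_i. As q_i = p_i, local convexity would carry such an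
    edge at p along (al x)(p,q) to one at q. *)
Lemma concat_boundary p i : deg_le_ext p D -> D i = Some (p i) ->
  paths_at (src (concat_head al p)) (unit_deg i) = set0.
Proof.
move=> pD Di.
set q := kdeg al + deg_sub p (kdeg al).
have pq : deg_le p q by apply: deg_le_sub_add.
have px := deg_le_ext_sub pD.
have qD : deg_le_ext q D.
  move=> j; move: (px j); rewrite [D j]ffunE degE.
  by case: (bdeg x j) => //= a; rewrite leq_add2l.
have [a xi pi] : exists2 a, bdeg x i = Some a & p i = (kdeg al i + a)%N.
  by move: Di; rewrite ffunE; case: (bdeg x i) => //= a [<-]; exists a.
have := @bmap_boundary _ _ x _ i px; rewrite xi ffunE pi addKn => /(_ erefl) E.
apply: contrapT => /eqP/set0P ne.
have : paths_at (src (concat_head al q)) (unit_deg i) !=set0.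
  rewrite -(src_concat_map pq qD); apply: locally_convex_src => //.
    by rewrite kdeg_concat_map // /q ffunE degE ffunE pi; lia.
  by rewrite rng_concat_map.
rewrite concat_head_add // src_kcomp ?rng_xhead // src_xhead // E.
by move=> [].
Qed.

Definition bconcat : boundary_path L.
Proof.
apply: (@BoundaryPath _ L D concat_map).
- by move=> p q pq qD i; rewrite kdeg_concat_map // ffunE.
- move=> p q pq qD; have pD := deg_le_ext_trans pq qD.
  by rewrite !rng_concat_map.
- by move=> p q pq qD; rewrite src_concat_map // rng_concat_map.
- by move=> p pD; rewrite concat_map_id // rng_kid.
- move=> p q t pq qt tD; have qD := deg_le_ext_trans qt tD.
  have [_ _ c1 e1] := concat_head_split pq qD.
  have [_ _ c2 e2] := concat_head_split qt tD.
  have c3 : src (concat_map p q) = rng (concat_map q t).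
    by rewrite src_concat_map // rng_concat_map.
  apply: concat_mapE => //; first exact: deg_le_trans qt.
    by rewrite rng_kcomp.
  by rewrite kcompA // -e1.
- move=> p i pD; rewrite rng_concat_map //; exact: concat_boundary.
Defined.

Lemma bconcatP : is_concat al x bconcat.
Proof.
split=> //; last exact: concat_map_add.
have x0 := @deg_le_ext0 _ (bdeg x).
have dD : deg_le_ext (kdeg al) D.
  by move=> i; rewrite ffunE; case: (bdeg x i) => //= a; rewrite leq_addr.
have e : concat_head al (kdeg al) = al.
  have := concat_head_add x0; rewrite addr0 => ->.
  by rewrite /xhead bmap_id // -[rng _]/(brng x) -al_x kcomp1r.
(* The value at (0, d(al)) is obtained by cancelling the initial segment of degree 0, so that
   segment has to be identified as the vertex r(al). *)
have h0 : concat_head al 0 = kid (rng al).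
  have D0 := @deg_le_ext0 _ D.
  have := kpath_deg0 (kdeg_concat_head D0) => ->; congr kid.
  rewrite rng_khead; last exact: kdeg_concat_comp.
  by rewrite rng_kcomp // rng_xhead //; apply: deg_le_ext_sub.
apply: concat_mapE => //; [exact: deg_le0|by rewrite h0 src_kid|rewrite h0 e].
by rewrite kcomp1l.
Qed.

End Concat.

(** The initial segments determine all values (al x)(p,q), so distinct concatenations of equal
    degree already differ in an initial segment. *)
Lemma concat_neq al be : src al = brng x -> src be = brng x ->
  (forall alx bex, is_concat al x alx -> is_concat be x bex ->
    ~ bpath_eq alx bex) ->
  deg_add_ext (kdeg al) (bdeg x) = deg_add_ext (kdeg be) (bdeg x) ->
  exists2 q, deg_le_ext q (deg_add_ext (kdeg al) (bdeg x)) &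
    concat_head al q <> concat_head be q.
Proof.
move=> a_x b_x neq dE; apply: contrapT => nex.
apply: (neq _ _ (bconcatP a_x) (bconcatP b_x)); split=> // p q pq qD.
rewrite /= /concat_map; congr ktail.
by apply: contrapT => ne; apply: nex; exists q.
Qed.

(* The common extensions that make up [S_{al x(0,m)}^* S_{be x(0,m)}] all
   disappear as soon as [m] is large enough to see that [al x <> be x]. *)
Lemma no_common_extension al be : src al = brng x -> src be = brng x ->
  (forall alx bex, is_concat al x alx -> is_concat be x bex ->
    ~ bpath_eq alx bex) ->
  exists2 m, deg_le_ext m (bdeg x) &
    forall n, deg_le m n -> deg_le_ext n (bdeg x) -> forall ze et : kpath L,
      src (xhead n) = rng ze -> src (xhead n) = rng et ->
      kcomp (kcomp al (xhead n)) ze <> kcomp (kcomp be (xhead n)) et.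
Proof.
move=> a_x b_x neq.
have [dE|] := pselect (deg_add_ext (kdeg al) (bdeg x) =
                       deg_add_ext (kdeg be) (bdeg x)).
  have [q qD hq] := concat_neq a_x b_x neq dE.
  have qa := deg_le_ext_sub qD.
  have qb : deg_le_ext (deg_sub q (kdeg be)) (bdeg x).
    by apply: deg_le_ext_sub; rewrite -dE.
  (* For n beyond this bound, q is below both d(al) + n and d(be) + n. A common extension would then
     have (al x)(0,q) and (be x)(0,q) as its initial segment of degree q, although they differ. *)
  exists (deg_max (deg_sub q (kdeg al)) (deg_sub q (kdeg be))).
    exact: deg_le_ext_max.
  move=> n mn nx ze et cze cet e; apply: hq.
  have mn1 := deg_le_trans (@deg_le_maxl _ _ _) mn.
  have mn2 := deg_le_trans (@deg_le_maxr _ _ _) mn.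
  have qn ga : deg_le (deg_sub q (kdeg ga)) n -> deg_le q (kdeg ga + n).
    by move=> h i; move: (h i); rewrite degE ffunE leq_subLR.
  have head ga th : src ga = brng x -> src (xhead n) = rng th ->
      deg_le (deg_sub q (kdeg ga)) n ->
      concat_head ga q = khead (kcomp (kcomp ga (xhead n)) th) q.
    move=> ga_x c /qn h; rewrite (concat_headP ga_x nx) //.
    have gn : src ga = rng (xhead n) by rewrite rng_xhead.
    rewrite [RHS]khead_comp ?src_kcomp //.
    by rewrite kdeg_kcomp // kdeg_xhead //.
  by rewrite (head _ ze) // (head _ et) // e.
move/ffunP/existsNP => [i]; rewrite !ffunE.
case xi: (bdeg x i) => [a|] //= neqi.
(* Degrees that differ at i force d(x)_i to be a finite a. Once n_i = a, no edge of degree e_i has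
   range s(x(0,n)), so ze and et have i-th degree 0, and a common extension would equate d(al)_i + a
   with d(be)_i + a. *)
exists [ffun j => if j == i then a else 0%N].
  move=> j; rewrite ffunE; case: eqP => [->|_]; first by rewrite xi.
  by case: (bdeg x j).
move=> n mn nx ze et cze cet e; apply: neqi.
have ni : n i = a.
  move: (mn i) (nx i); rewrite ffunE eqxx xi => h1 h2; lia.
have E := bmap_boundary nx; have := E i; rewrite xi ni => /(_ erefl).
rewrite -src_xhead // => Ei.
have zi : kdeg ze i = 0%N by apply: no_edge_deg; rewrite -cze.
have ti : kdeg et i = 0%N by apply: no_edge_deg; rewrite -cet.
have := congr1 (fun la => kdeg la i) e.
rewrite /= !kdeg_kcomp ?src_kcomp ?rng_xhead // kdeg_xhead // !degE zi ti ni.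
by rewrite !addn0 => ->.
Qed.

End BoundaryPaths.

(** * Bilinearity of the product and collection of linear combinations *)

Section NualgTheory.
Variables (R : comPzRingType) (A : nualgType R).
Implicit Types a b : A.

Lemma amul0l b : amul 0 b = 0.
Proof. by rewrite -(scale0r (0 : A)) amulZl !scale0r. Qed.

Lemma amul0r a : amul a 0 = 0.
Proof. by rewrite -(scale0r (0 : A)) amulZr !scale0r. Qed.

Lemma amul_suml (I : Type) (s : seq I) (F : I -> A) b :
  amul (\sum_(i <- s) F i) b = \sum_(i <- s) amul (F i) b.
Proof.
by apply: (big_morph (fun a => amul a b)) => [? ?|]; rewrite ?amulDl ?amul0l.
Qed.

Lemma amul_sumr (I : Type) (s : seq I) (F : I -> A) a :
  amul a (\sum_(i <- s) F i) = \sum_(i <- s) amul a (F i).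
Proof.
by apply: (big_morph (amul a)) => [? ?|]; rewrite ?amulDr ?amul0r.
Qed.

End NualgTheory.

(** Merges repeated terms, so that the coefficient of an index is its total contribution and can be
    isolated from the terms with other indices. *)
Lemma sum_scale_undup (R : pzRingType) (V : lmodType R) (T : eqType)
    (e : T -> V) (w : seq (R * T)) :
  \sum_(x <- w) x.1 *: e x.2 =
  \sum_(y <- undup (map snd w)) (\sum_(x <- w | x.2 == y) x.1) *: e y.
Proof.
under [RHS]eq_bigr do rewrite scaler_suml big_mkcond.
rewrite exchange_big /= big_seq [RHS]big_seq; apply: eq_bigr => x xw.
rewrite (bigD1_seq x.2) ?undup_uniq ?eqxx //=; last by rewrite mem_undup map_f.
by rewrite big1 ?addr0 // => y; rewrite eq_sym => /negPf->.
Qed.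

(** * Kumjian-Pask relations in all degrees and the span of the S_al S_be^* *)

Section KPFamilies.
Variables (k : nat) (L : kgraph k) (hRF : row_finite L).
Variables (R : comPzRingType) (A : nualgType R) (QT : kp_family L A).
Implicit Types (v w : vertex L) (la mu al be : kpath L) (m n : deg k).

Local Notation P := (kpP QT).
Local Notation S := (kpS QT).
Local Notation G := (kpG QT).
Local Notation "a ** b" := (amul a b) (at level 40, left associativity).

Lemma kpPS la : P (rng la) ** S la = S la.
Proof.
have [/kpath_deg0 -> |/kp2_PS -> //] := eqVneq (kdeg la) 0.
by rewrite kpS_id rng_kid kp1 eqxx.
Qed.

Lemma kpSP la : S la ** P (src la) = S la.
Proof.
have [/kpath_deg0 -> |/kp2_SP -> //] := eqVneq (kdeg la) 0.
by rewrite kpS_id src_kid kp1 eqxx.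
Qed.

Lemma kpPG la : P (src la) ** G la = G la.
Proof.
have [/kpath_deg0 -> |/kp2_PG -> //] := eqVneq (kdeg la) 0.
by rewrite kpG_id src_kid kp1 eqxx.
Qed.

Lemma kpGP la : G la ** P (rng la) = G la.
Proof.
have [/kpath_deg0 -> |/kp2_GP -> //] := eqVneq (kdeg la) 0.
by rewrite kpG_id rng_kid kp1 eqxx.
Qed.

Lemma kpSS la mu : src la = rng mu -> S la ** S mu = S (kcomp la mu).
Proof.
have [/kpath_deg0 -> |la0] := eqVneq (kdeg la) 0.
  by rewrite src_kid => ->; rewrite kpS_id kpPS kcomp1l.
have [/kpath_deg0 -> |mu0] := eqVneq (kdeg mu) 0.
  by rewrite rng_kid => <-; rewrite kpS_id kpSP kcomp1r.
by move=> c; rewrite kp2_S.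
Qed.

Lemma kpGG la mu : src la = rng mu -> G mu ** G la = G (kcomp la mu).
Proof.
have [/kpath_deg0 -> |la0] := eqVneq (kdeg la) 0.
  by rewrite src_kid => ->; rewrite kpG_id kpGP kcomp1l.
have [/kpath_deg0 -> |mu0] := eqVneq (kdeg mu) 0.
  by rewrite rng_kid => <-; rewrite kpG_id kpPG kcomp1r.
by move=> c; rewrite kp2_G.
Qed.

(** (KP3') with n = 0 included: Lambda^{<=0} consists of the vertices, where the relation is
    (KP1). *)
Lemma kpGS n la mu : paths_le n la -> paths_le n mu ->
  G la ** S mu = if la == mu then P (src la) else 0.
Proof.
have [->|n0] := eqVneq n 0; last exact: kp3.
have d0 nu : paths_le 0 nu -> nu = kid (rng nu).
  case=> le0 _; apply/kpath_deg0/ffunP => i.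
  by move: (le0 i); rewrite !degE; case: (kdeg nu i).
move=> /d0 -> /d0 ->.
by rewrite kpG_id kpS_id kp1 (inj_eq (@kid_inj _ L)) src_kid.
Qed.

Lemma kpGS_id la : G la ** S la = P (src la).
Proof. by rewrite (@kpGS (kdeg la)) ?eqxx //; apply: paths_le_kdeg. Qed.

Definition paths_seq v n : seq (kpath L) := fset_set (paths_le_at v n).

Lemma mem_paths_seq v n la :
  la \in paths_seq v n -> rng la = v /\ paths_le n la.
Proof.
by rewrite /paths_seq in_fset_set; [rewrite inE|apply: finite_paths_le].
Qed.

(** (KP4') with n = 0 included, where v itself is the only summand. Row-finiteness turns the
    finite-support sum into one over a list. *)
Lemma kpP_sum v n : P v = \sum_(la <- paths_seq v n) S la ** G la.
Proof.
have fin := finite_paths_le hRF v n.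
rewrite /paths_seq -fsbig_finite //.
have [n0|n0] := eqVneq n 0; last exact: kp4.
suff -> : paths_le_at v n = [set kid v].
  by rewrite fsbig_set1 kpS_id kpG_id kp1 eqxx.
rewrite n0; apply/seteqP; split=> la /=; last first.
  move=> ->; split; rewrite ?rng_kid // -(@kdeg_kid _ L v).
  exact: paths_le_kdeg.
case=> <- [le0 _]; apply/kpath_deg0/ffunP => i.
by move: (le0 i); rewrite !degE; case: (kdeg la i).
Qed.

Lemma kpS_sum al n :
  S al = \sum_(la <- paths_seq (src al) n) S (kcomp al la) ** G la.
Proof.
rewrite -{1}kpSP (kpP_sum _ n) amul_sumr !big_seq.
by apply: eq_bigr => la /mem_paths_seq[r _]; rewrite amulA kpSS.
Qed.

Lemma kpG_sum be n :
  G be = \sum_(la <- paths_seq (src be) n) S la ** G (kcomp be la).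
Proof.
rewrite -{1}kpPG (kpP_sum _ n) amul_suml !big_seq.
by apply: eq_bigr => la /mem_paths_seq[r _]; rewrite -amulA kpGG.
Qed.

(** Inserting (KP4') at the common source lengthens both legs together; this is how all second legs
    are brought into one Lambda^{<=n}. *)
Lemma kpSG_sum al be n : src al = src be ->
  S al ** G be =
  \sum_(la <- paths_seq (src be) n) S (kcomp al la) ** G (kcomp be la).
Proof.
move=> c; rewrite (kpG_sum be n) amul_sumr !big_seq.
by apply: eq_bigr => la /mem_paths_seq[r _]; rewrite amulA kpSS ?c.
Qed.

(** (KP4') at the two sources extends al and be into Lambda^{<=n}, and there (KP3') leaves only the
    pairs with a common extension. *)
Lemma kpGS_sum al be : let n := deg_max (kdeg al) (kdeg be) in
  G al ** S be =
  \sum_(ze <- paths_seq (src al) (deg_sub n (kdeg al)))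
    \sum_(et <- paths_seq (src be) (deg_sub n (kdeg be)))
      if kcomp al ze == kcomp be et then S ze ** G et else 0.
Proof.
move=> n; rewrite (kpG_sum al (deg_sub n (kdeg al))) amul_suml !big_seq.
apply: eq_bigr => ze /mem_paths_seq[rze leze].
rewrite (kpS_sum be (deg_sub n (kdeg be))) amul_sumr !big_seq.
apply: eq_bigr => et /mem_paths_seq[ret leet].
rewrite -amulA [G _ ** _]amulA (@kpGS n); first last.
- by apply: paths_le_comp => //; apply: deg_le_maxr.
- by apply: paths_le_comp => //; apply: deg_le_maxl.
case: eqP => [e|_]; last by rewrite amul0l amul0r.
by rewrite amulA src_kcomp // kpSP.
Qed.

Inductive kp_span : A -> Prop :=
| kp_span0 : kp_span 0
| kp_spanD a b : kp_span a -> kp_span b -> kp_span (a + b)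
| kp_spanZ (r : R) a : kp_span a -> kp_span (r *: a)
| kp_spanSG al be : src al = src be -> kp_span (S al ** G be).

Lemma kp_span_sum (I : eqType) (s : seq I) (F : I -> A) :
  (forall i, i \in s -> kp_span (F i)) -> kp_span (\sum_(i <- s) F i).
Proof.
move=> sF; rewrite big_seq; apply: big_ind => // [|a b]; first exact: kp_span0.
exact: kp_spanD.
Qed.

Lemma kp_spanP v : kp_span (P v).
Proof.
rewrite -[P v](@kpS_id _ _ _ _ QT) -[S _]kpSP -kpG_id.
by apply: kp_spanSG; rewrite !src_kid.
Qed.

Lemma kp_spanS la : kp_span (S la).
Proof. by rewrite -kpSP -kpG_id; apply: kp_spanSG; rewrite src_kid. Qed.

Lemma kp_spanG la : kp_span (G la).
Proof. by rewrite -kpPG -kpS_id; apply: kp_spanSG; rewrite src_kid. Qed.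

(** In S_al (S_be^* S_ga) S_de^* the middle product expands into terms S_ze S_et^* with be ze = ga
    et, which are absorbed into S_{al ze} S_{de et}^*. *)
Lemma kp_spanM a b : kp_span a -> kp_span b -> kp_span (a ** b).
Proof.
elim=> [|a1 a2 _ ? _ ?|r a1 _ ?|al be c] sb.
- by rewrite amul0l; apply: kp_span0.
- by rewrite amulDl; apply: kp_spanD; auto.
- by rewrite amulZl; apply: kp_spanZ; auto.
elim: sb => [|b1 b2 _ ? _ ?|r b1 _ ?|ga de c'].
- by rewrite amul0r; apply: kp_span0.
- by rewrite amulDr; apply: kp_spanD; auto.
- by rewrite amulZr; apply: kp_spanZ; auto.
rewrite -amulA [G be ** _]amulA kpGS_sum amul_suml amul_sumr.
apply: kp_span_sum => ze /mem_paths_seq[rze _].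
rewrite amul_suml amul_sumr; apply: kp_span_sum => et /mem_paths_seq[ret _].
case: eqP => [e|_]; last by rewrite amul0l amul0r; apply: kp_span0.
rewrite -amulA kpGG ?ret // amulA kpSS ?rze //; apply: kp_spanSG.
rewrite !src_kcomp ?ret ?rze //.
by have := congr1 (@src _ _) e; rewrite !src_kcomp.
Qed.

(** Asking for every n above a threshold lets two summands be written with the same n, namely any n
    above both thresholds. *)
Lemma kp_span_coeffs a : kp_span a -> exists m, forall n, deg_le m n ->
  exists2 w : seq (R * (kpath L * kpath L)),
    (forall x, x \in w -> src x.2.1 = src x.2.2 /\ paths_le n x.2.2) &
    a = \sum_(x <- w) x.1 *: (S x.2.1 ** G x.2.2).
Proof.
elim=> [|a1 a2 _ [m1 h1] _ [m2 h2]|r a1 _ [m h]|al be c].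
- by exists 0 => n _; exists [::]; rewrite ?big_nil.
- exists (deg_max m1 m2) => n le.
  have [w1 p1 ->] := h1 _ (deg_le_trans (@deg_le_maxl _ _ _) le).
  have [w2 p2 ->] := h2 _ (deg_le_trans (@deg_le_maxr _ _ _) le).
  exists (w1 ++ w2); last by rewrite big_cat.
  by move=> x; rewrite mem_cat => /orP[/p1|/p2].
- exists m => n /h[w p ->]; exists [seq (r * x.1, x.2) | x <- w].
    by move=> _ /mapP[x /p ? ->].
  by rewrite big_map scaler_sumr; apply: eq_bigr => x _; rewrite scalerA.
- exists (kdeg be) => n le; rewrite (kpSG_sum (deg_sub n (kdeg be)) c).
  exists [seq (1, (kcomp al la, kcomp be la)) |
      la <- paths_seq (src be) (deg_sub n (kdeg be))].
    move=> _ /mapP[la /mem_paths_seq[rla lela] ->] /=.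
    by split; [rewrite !src_kcomp ?c|apply: paths_le_comp].
  by rewrite big_map; apply: eq_bigr => la _; rewrite scale1r.
Qed.

Lemma kp_span_nf a : kp_span a -> exists m, forall n, deg_le m n ->
  exists2 t : seq (kpath L * kpath L),
    uniq t /\ (forall y, y \in t -> src y.1 = src y.2 /\ paths_le n y.2) &
    exists c : kpath L * kpath L -> R,
    a = \sum_(y <- t) c y *: (S y.1 ** G y.2).
Proof.
move=> /kp_span_coeffs[m h]; exists m => n /h[w p ->].
exists (undup (map snd w)).
  split; first exact: undup_uniq.
  by move=> y; rewrite mem_undup => /mapP[x /p ? ->].
exists (fun y => \sum_(x <- w | x.2 == y) x.1).
exact: (sum_scale_undup (fun y => S y.1 ** G y.2)).
Qed.

(** * Compression along an aperiodic boundary path *)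

Hypotheses (hLC : locally_convex L).

(** Every nonzero term of [kpGS_sum] would come from a common extension, and for large n there is
    none. *)
Lemma kpGS_xhead_eq0 (x : boundary_path L) al be :
  src al = brng x -> src be = brng x ->
  (forall alx bex, is_concat al x alx -> is_concat be x bex ->
    ~ bpath_eq alx bex) ->
  exists2 m, deg_le_ext m (bdeg x) &
    forall n, deg_le m n -> deg_le_ext n (bdeg x) ->
      G (kcomp al (xhead x n)) ** S (kcomp be (xhead x n)) = 0.
Proof.
move=> a_x b_x /(no_common_extension hLC a_x b_x)[m mx nce].
exists m => // n mn nx; rewrite kpGS_sum.
rewrite big_seq big1 // => ze /mem_paths_seq[rze _].
rewrite big_seq big1 // => et /mem_paths_seq[ret _]; case: eqP => // e.
rewrite src_kcomp ?rng_xhead // in rze; rewrite src_kcomp ?rng_xhead // in ret.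
by have := nce n mn nx ze et (esym rze) (esym ret) e.
Qed.

Lemma kpGS_xhead_eq0_seq (x : boundary_path L) al (s : seq (kpath L)) :
  (forall al be, src al = brng x -> src be = brng x -> al <> be ->
    forall alx bex, is_concat al x alx -> is_concat be x bex ->
    ~ bpath_eq alx bex) ->
  src al = brng x ->
  exists2 n, deg_le_ext n (bdeg x) &
    forall be, be \in s -> src be = brng x -> al <> be ->
      G (kcomp al (xhead x n)) ** S (kcomp be (xhead x n)) = 0.
Proof.
(* Strengthened to all n above m, so that the induction on s can take the maximum of two
   thresholds. *)
move=> ap a_x; suff [m mx h] : exists2 m, deg_le_ext m (bdeg x) &
    forall n, deg_le m n -> deg_le_ext n (bdeg x) ->
    forall be, be \in s -> src be = brng x -> al <> be ->
      G (kcomp al (xhead x n)) ** S (kcomp be (xhead x n)) = 0.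
  by exists m => //; apply: h => //; apply: deg_le_refl.
elim: s => [|ga s [m mx IH]]; first by exists 0 => //; apply: deg_le_ext0.
have [[g_x ag]|ng] := pselect (src ga = brng x /\ al <> ga); last first.
  exists m => // n mn nx be; rewrite inE => /predU1P[->|]; last exact: IH.
  by move=> *; exfalso; apply: ng.
have [m' m'x h] := kpGS_xhead_eq0 a_x g_x (ap _ _ a_x g_x ag).
exists (deg_max m m'); first exact: deg_le_ext_max.
move=> n mn nx be; have mn1 := deg_le_trans (@deg_le_maxl _ _ _) mn.
have mn2 := deg_le_trans (@deg_le_maxr _ _ _) mn.
by rewrite inE => /predU1P[-> _ _|]; [apply: h|apply: IH].
Qed.

Lemma coeff_extract (hAP : aperiodic L) n (t : seq (kpath L * kpath L))
    (c : kpath L * kpath L -> R) y0 :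
  uniq t -> (forall y, y \in t -> src y.1 = src y.2 /\ paths_le n y.2) ->
  y0 \in t -> exists b d v,
    b ** (\sum_(y <- t) c y *: (S y.1 ** G y.2)) ** d = c y0 *: P v.
Proof.
case: y0 => al be ut ht y0t; have [/= c0 le0] := ht _ y0t.
have [x [rx ap]] := hAP (src al); rewrite -rx in ap.
(* One m serves all first legs occurring in t. *)
have [m mx h] := @kpGS_xhead_eq0_seq x al (map fst t) ap (esym rx).
exists (G (kcomp al (xhead x m))), (S be ** S (xhead x m)), (src (xhead x m)).
have a_x : src al = rng (xhead x m) by rewrite rng_xhead.
rewrite amul_sumr amul_suml (bigD1_seq (al, be)) //= big_seq_cond.
rewrite big1 => [|[al' be']].
  rewrite addr0 amulZr amulZl -!amulA [G be ** _]amulA kpGS_id -c0.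
  by rewrite [S al ** _]amulA kpSP kpSS // kpGS_id src_kcomp.
rewrite /= => /andP[yt ne]; have [/= c1 le1] := ht _ yt.
rewrite amulZr amulZl -!amulA [G be' ** _]amulA (kpGS le1 le0).
(* Terms with be' != be vanish by (KP3') in Lambda^{<=n}. The remaining ones have al' != al and the
   same source as al, so the choice of m removes them. *)
case: eqP => [e|_]; last by rewrite amul0l !amul0r scaler0.
rewrite -{}e in c0 ne *.
have a'_x : src al' = brng x by rewrite c1 -c0.
rewrite -c1 [S al' ** _]amulA kpSP kpSS ?rng_xhead // h ?scaler0 //.
  by apply/mapP; exists (al', be').
by move=> e; rewrite e eqxx in ne.
Qed.

End KPFamilies.

(** * The span as an algebra with its own Kumjian-Pask family *)

Section SpanAlgebra.
Variables (k : nat) (L : kgraph k) (hRF : row_finite L).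
Variables (R : comPzRingType) (K : nualgType R) (ps : kp_family L K).

Definition in_kp_span : {pred K} := fun a => `[< kp_span ps a >].

Lemma in_kp_spanP a : reflect (kp_span ps a) (a \in in_kp_span).
Proof. exact: asboolP. Qed.

Fact in_kp_span_submod : submod_closed in_kp_span.
Proof.
split=> [|r a b /in_kp_spanP sa /in_kp_spanP sb]; apply/in_kp_spanP.
  exact: kp_span0.
by apply: kp_spanD => //; apply: kp_spanZ.
Qed.

HB.instance Definition _ :=
  GRing.isSubmodClosed.Build R K in_kp_span in_kp_span_submod.

Definition kp_sub : Type := {a : K | a \in in_kp_span}.
HB.instance Definition _ := SubChoice.on kp_sub.
HB.instance Definition _ := [SubChoice_isSubLmodule of kp_sub by <:].

Definition mk_kp_sub a (sa : kp_span ps a) : kp_sub :=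
  exist _ a (introT (in_kp_spanP a) sa).

Lemma kp_subP (u : kp_sub) : kp_span ps (val u).
Proof. exact/in_kp_spanP/valP. Qed.

Definition kp_sub_mul (u v : kp_sub) : kp_sub :=
  mk_kp_sub (kp_spanM hRF (kp_subP u) (kp_subP v)).

Lemma kp_sub_mulE u v : val (kp_sub_mul u v) = amul (val u) (val v).
Proof. by []. Qed.

Definition kp_sub_alg : nualgType R.
Proof.
apply: (@NuAlg R kp_sub kp_sub_mul) => *; apply/val_inj;
  rewrite ?(raddfD, linearZ) /= ?kp_sub_mulE ?(raddfD, linearZ) /=.
- exact: amulA.
- exact: amulDl.
- exact: amulDr.
- exact: amulZl.
- exact: amulZr.
Defined.

(** A target for the universal property. The relations are inherited from [ps] because the inclusion
    of the span is injective. *)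
Definition kp_sub_family : kp_family L kp_sub_alg.
Proof.
apply: (@KPFamily _ L R kp_sub_alg (fun v => mk_kp_sub (kp_spanP ps v))
  (fun la => mk_kp_sub (kp_spanS ps la))
  (fun la => mk_kp_sub (kp_spanG ps la))).
- by move=> v; apply/val_inj/kpS_id.
- by move=> v; apply/val_inj/kpG_id.
- by move=> v w; apply/val_inj; rewrite /= kp1; case: ifP.
- by move=> la mu l0 m0 c; apply/val_inj/kp2_S.
- by move=> la mu l0 m0 c; apply/val_inj/kp2_G.
- by move=> la l0; apply/val_inj/kp2_PS.
- by move=> la l0; apply/val_inj/kp2_SP.
- by move=> la l0; apply/val_inj/kp2_PG.
- by move=> la l0; apply/val_inj/kp2_GP.
- move=> n n0 la mu l1 l2; apply/val_inj; rewrite /= (kp3 _ n0) //.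
  by case: ifP.
(* The index set is finite, so the inclusion commutes with the sum in (KP4'). *)
- move=> v n n0; have fin := finite_paths_le hRF v n.
  apply/val_inj; rewrite fsbig_finite // raddf_sum /=.
  exact: kpP_sum.
Defined.

(* [K] maps onto its span, and composing with the inclusion gives the identity
   by uniqueness. *)
Lemma kp_span_total : is_KP_algebra ps -> forall a, kp_span ps a.
Proof.
move=> hK a; have [[f [[fD fZ fM] [fP fS fG]]] _] := hK _ kp_sub_family.
have [_ /(_ (fun a => val (f a)) id)/(_ _ _ _ _ a) <-] := hK _ ps;
  first exact: kp_subP; split=> //=.
- by move=> u v; rewrite fD.
- by move=> r u; rewrite fZ.
- by move=> u v; rewrite fM.
- by move=> v; rewrite fP.
- by move=> la; rewrite fS.
- by move=> la; rewrite fG.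
Qed.

End SpanAlgebra.

Theorem theorem4p2 (k : nat) (hk : (1 <= k)%N) (R : comPzRingType)
    (L : kgraph k) (hLC : locally_convex L) (hRF : row_finite L)
    (hAP : aperiodic L)
    (K : nualgType R) (ps : kp_family L K) (hK : is_KP_algebra ps)
    (A : nualgType R) (phi : K -> A) (hphi : alg_hom phi)
    (hne : forall (r : R) (v : vertex L), r != 0 -> phi (r *: kpP ps v) != 0) :
  injective phi.
Proof.
have [phiD phiZ phiM] := hphi.
suff ker0 a : phi a = 0 -> a = 0.
  move=> a b e; apply/eqP; rewrite -subr_eq0; apply/eqP/ker0.
  by rewrite phiD -scaleN1r phiZ e scaleN1r subrr.
have [m /(_ m (deg_le_refl m))[t [ut ht] [c ->]]] :=
  kp_span_nf hRF (kp_span_total hRF hK a).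
move=> phi0; rewrite big_seq big1 // => y yt.
(* The map phi sends the compressed element to phi(b) 0 phi(d) = 0, but that element is
   [c y *: kpP ps v]; the hypothesis on phi thus forces [c y = 0]. *)
have [b [d [v e]]] := coeff_extract hRF ps hLC hAP c ut ht yt.
suff -> : c y = 0 by rewrite scale0r.
apply: contrapT => /eqP /(hne _ v).
by rewrite -e !phiM phi0 amul0r amul0l eqxx.
Qed.
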